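(* Let $n,\lambda\ge2$ be even integers, $m=1+\frac{\lambda}{2}$, $\sigma>0$ and $\delta>0$. Let $\rho$, $c_0$, $k$ and the function $MN:[c_0,\infty)\to(0,\infty)$ be as defined in the context. If $\lambda-n-1\le0$ and $k<0$, then the larger $c\in[c_0,\infty)$ is, the better it is; that is, $c_0\le c<c'$ implies $MN(c')<MN(c)$.
   Context: The constant $\rho$ is: $\rho=1+\frac{s}{2m+3}$ with $s=\lceil\frac{n-\lambda-3}{2}\rceil$ if $n-\lambda>3$; $\rho=1$ if $n-\lambda\le3$. $c_0:=24\rho(m+1)\delta$, $k:=\frac{\sigma}{2}+\frac{\ln\frac23}{24\rho\delta}$. The MN function (for band-limited functions in $B_\sigma$, with the domain size $b_0$ not fixed) is $$MN(c)=\sqrt{8\rho}\,c^{\frac{\lambda-n-1}{4}}e^{c\left[\frac{\sigma}{2}+\frac{\ln\frac23}{24\rho\delta}\right]},\qquad c\in[c_0,\infty).$$ A value of $c$ is better than another if it gives a smaller value of $MN$. *)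

(* Defs.v *)
(* MathComp-Analysis; the real line is an arbitrary [R : realType]. *)
From mathcomp Require Import all_boot all_order all_algebra.
From mathcomp Require Import reals sequences exp.

Set Implicit Arguments.
Unset Strict Implicit.
Unset Printing Implicit Defensive.

Import Order.TTheory GRing.Theory Num.Theory.
Local Open Scope ring_scope.

(* Differences of [n] and [lambda] are taken in [R], since subtraction on [nat]
   truncates. *)
Definition rho (R : realType) (n lambda m : nat) : R :=
  if n%:R - lambda%:R <= 3 :> R then 1
  else let s : int := Num.ceil ((n%:R - lambda%:R - 3) / 2 : R) in
       1 + s%:~R / (2 * m%:R + 3).

Definition c0 (R : realType) (n lambda m : nat) (delta : R) : R :=
  24 * rho R n lambda m * (m%:R + 1) * delta.

Definition k (R : realType) (n lambda m : nat) (sigma delta : R) : R :=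
  sigma / 2 + ln (2 / 3) / (24 * rho R n lambda m * delta).

(* Defined for every real [c], but meaningful only on [c0, +oo[, where [c] is
   positive. *)
Definition MN (R : realType) (n lambda m : nat) (sigma delta c : R) : R :=
  Num.sqrt (8 * rho R n lambda m)
  * powR c ((lambda%:R - n%:R - 1) / 4)
  * expR (c * k n lambda m sigma delta).

(* Main.v *)
Require Import Defs.
From mathcomp Require Import all_boot all_order all_algebra.
From mathcomp Require Import reals sequences exp.

Set Implicit Arguments.
Unset Strict Implicit.
Unset Printing Implicit Defensive.

Import Order.TTheory GRing.Theory Num.Theory.
Local Open Scope ring_scope.

(** [MN] is a positive constant times a power of [c] with nonpositive exponent times [expR (c * k)]
    with [k < 0]: the power does not increase with [c], and the exponential strictly decreases.
    Positivity of [rho] makes [c0], hence [c], positive, as well as the constant. *)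

Lemma rho_gt0 (R : realType) (n lambda m : nat) : 0 < rho R n lambda m.
Proof.
rewrite /rho; case: ifPn => // ; rewrite -ltNge => h.
apply: ltr_pwDl => //; apply: divr_ge0; last by rewrite addr_ge0 ?mulr_ge0.
rewrite ler0z ltW // ceil_gt0.
by rewrite divr_gt0 // subr_gt0.
Qed.

(** For a positive base, [powR x a] is [expR (a * ln x)]; [ln] is increasing and a factor [a <= 0]
    reverses the order. *)
Lemma le0_powR_nincr (R : realType) (a x y : R) :
  a <= 0 -> 0 < x -> x <= y -> powR y a <= powR x a.
Proof.
move=> a0 x0 xy; have y0 := lt_le_trans x0 xy.
by rewrite /powR !gt_eqF // ler_expR ler_wnM2l // ler_ln.
Qed.

Theorem mainTheorem10 (R : realType) (n lambda m : nat) (sigma delta : R)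
    (hn2 : (2 <= n)%N) (hn_even : ~~ odd n)
    (hlambda2 : (2 <= lambda)%N) (hlambda_even : ~~ odd lambda)
    (hm : m = (1 + lambda %/ 2)%N)
    (hsigma : 0 < sigma) (hdelta : 0 < delta)
    (hexp : lambda%:R - n%:R - 1 <= 0 :> R)
    (hk : k n lambda m sigma delta < 0) :
  forall c c' : R, c0 n lambda m delta <= c -> c < c' ->
    MN n lambda m sigma delta c' < MN n lambda m sigma delta c.
Proof.
move=> c c' hc cc'.
have rho0 := rho_gt0 R n lambda m.
have c_gt0 : 0 < c.
  apply: lt_le_trans hc.
  by rewrite /c0 !mulr_gt0 // ltr_wpDl.
(* The intermediate value takes the power at [c] but the exponential at [c'], so only one factor
   changes at a time; strictness comes from the exponential. *)
apply: (@le_lt_trans _ _ (Num.sqrt (8 * rho R n lambda m)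
    * powR c ((lambda%:R - n%:R - 1) / 4)
    * expR (c' * k n lambda m sigma delta))).
  rewrite ler_wpM2r ?expR_ge0 // ler_wpM2l ?sqrtr_ge0 //.
  by apply: le0_powR_nincr => //; [rewrite pmulr_lle0 ?invr_gt0 | exact: ltW].
(* Cancelling the common prefactor requires it to be strictly positive. *)
rewrite ltr_pM2l; first by rewrite ltr_expR ltr_nM2r.
by rewrite mulr_gt0 ?powR_gt0 // sqrtr_gt0 mulr_gt0.
Qed.
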